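(* Let $k\ge 1$ be a fixed integer. For every constant $C>0$ there is a constant $C'>0$ (depending only on $k$ and $C$) such that every $(d,k)$-graph $G$ with $n\ge \mu_{d,k}-C\,d^{k/2}$ vertices satisfies $\lambda(G)\le C'\sqrt{d}$. (That is: if $n\ge\mu_{d,k}-O(d^{k/2})$ with $k$ constant, then $\lambda(G)=O(\sqrt d)$.)
   Context: A $(d,k)$-graph is a finite simple undirected $d$-regular graph of diameter $k$ (the maximum distance between two vertices is $k$), where $d,k\ge1$. The Moore Bound is $\mu_{d,k}:=1+d\sum_{i=0}^{k-1}(d-1)^i$ (with $0^0=1$). If $\lambda_1\ge\lambda_2\ge\dots\ge\lambda_n$ are the eigenvalues (with multiplicity) of the adjacency matrix of $G$ (so $\lambda_1=d$), then $\lambda(G):=\max\{|\lambda_2|,|\lambda_n|\}$. *)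

(* Defs.v *)
From HB Require Import structures.
From mathcomp Require Import all_boot all_order all_algebra.
From mathcomp Require Import polyrcf complex.
From mathcomp Require Import reals exp.

Set Implicit Arguments.
Unset Strict Implicit.
Unset Printing Implicit Defensive.

Import Order.TTheory GRing.Theory Num.Theory.
Local Open Scope ring_scope.

(* A finite simple graph is a symmetric irreflexive [e : rel T], T : finType. *)
Section Graphs.
Variables (T : finType) (e : rel T).

Definition regular (d : nat) := forall x : T, #|[set y | e x y]| = d.

Definition connected := forall x y : T, connect e x y.

Definition walk (m : nat) (x y : T) : bool :=
  [exists p : m.-tuple T, path e x p && (last x p == y)].

(* Distances in a connected graph are < #|T|, so this is the least length of  *)
(* a walk from x to y; when there is no such walk, the value is #|T|.         *)
Definition dist (x y : T) : nat := find (fun m => walk m x y) (iota 0 #|T|).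

(* Only meaningful when the graph is connected and nonempty. *)
Definition diameter : nat := (\max_(x : T) \max_(y : T) dist x y)%N.

Definition dk_graph (d k : nat) : Prop :=
  [/\ symmetric e, irreflexive e, regular d, connected & diameter = k].

End Graphs.

Definition moore_bound (d k : nat) : nat := (1 + d * \sum_(i < k) d.-1 ^ i)%N.

Section Spectrum.
Variable R : realType.

(* The real eigenvalues of A, in nonincreasing order, each one repeated       *)
(* according to its algebraic multiplicity; all n eigenvalues are there when  *)
(* A is symmetric (lemma [char_poly_spectrum]).                               *)
Definition spectrum (n : nat) (A : 'M[R]_n) : seq R :=
  sort >=%R
    (flatten [seq nseq (mup x (char_poly A)) x | x <- rootsR (char_poly A)]).

Definition adj_mx (T : finType) (e : rel T) : 'M[R]_#|T| :=
  \matrix_(i, j) (e (enum_val i) (enum_val j))%:R.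

(* Indices start at 0: lambda_2 and lambda_n are the items 1 and n.-1. *)
Definition lambda (T : finType) (e : rel T) : R :=
  let s := spectrum (adj_mx e) in Num.max `|s`_1| `|s`_(#|T|.-1)|.

Lemma spectrum_sorted n (A : 'M[R]_n) : sorted >=%R (spectrum A).
Proof. by apply: sort_sorted => x y; exact: le_total. Qed.

Lemma mup_prod_XsubC (s : seq R) x :
  mup x (\prod_(y <- s) ('X - y%:P)) = count_mem x s.
Proof.
elim: s => [|y s IHs]; first by rewrite big_nil mupNroot ?root1.
rewrite big_cons mupM ?polyXsubC_eq0 ?IHs //=; last first.
  by rewrite monic_neq0 // monic_prod_XsubC.
by congr addn; rewrite -['X - y%:P]expr1 mup_XsubCX eq_sym; case: eqP.
Qed.

Lemma perm_spectrum n (A : 'M[R]_n) (s : seq R) :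
  char_poly A = \prod_(y <- s) ('X - y%:P) -> perm_eq (spectrum A) s.
Proof.
move=> As; have A0 : char_poly A != 0 by rewrite monic_neq0 // char_poly_monic.
rewrite /spectrum perm_sort; apply/allP => x _ /=; apply/eqP.
set r := rootsR _.
have r_count : count_mem x r = (x \in s).
  rewrite count_uniq_mem ?uniq_roots // -roots_on_rootsR // in_itv /=.
  by rewrite As root_prod_XsubC.
have -> : count_mem x (flatten [seq nseq (mup y (char_poly A)) y | y <- r]) =
    (count_mem x r * count_mem x s)%N.
  elim: (r) => //= y r' IHr; rewrite count_cat IHr mulnDl count_nseq /=.
  by rewrite As mup_prod_XsubC; case: eqP => [->|].
rewrite r_count.
by case: (boolP (x \in s)) => [|/count_memPn ->]; rewrite ?mul1n ?muln0.
Qed.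

Lemma char_poly_conj (F : fieldType) n (P D : 'M[F]_n) :
  P \in unitmx -> char_poly (invmx P *m D *m P) = char_poly D.
Proof.
move=> Pu; rewrite /char_poly /char_poly_mx.
have PV : map_mx polyC (invmx P) *m map_mx polyC P = 1%:M.
  by rewrite -map_mxM mulVmx // map_mx1.
set DX := 'X%:M - map_mx polyC D.
have -> : 'X%:M - map_mx polyC (invmx P *m D *m P) =
    map_mx polyC (invmx P) *m DX *m map_mx polyC P.
  rewrite mulmxBr mulmxBl scalar_mxC; congr (_ - _).
    by rewrite -mulmxA PV mulmx1.
  by rewrite !map_mxM.
by rewrite !det_mulmx mulrAC -det_mulmx PV det1 mul1r.
Qed.

Lemma char_poly_spectrum n (A : 'M[R]_n) :
  A^T = A -> char_poly A = \prod_(x <- spectrum A) ('X - x%:P).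
Proof.
move=> At.
suff [s As] : exists s : seq R, char_poly A = \prod_(y <- s) ('X - y%:P).
  by rewrite As (perm_big _ (perm_spectrum As)).
pose B := map_mx (real_complex R) A.
have Bh : B \is hermsymmx.
  apply: realsym_hermsym.
    apply/is_hermitianmxP; rewrite expr0 scale1r.
    by apply/matrixP => i j; rewrite !mxE -{1}At mxE.
  by apply/mxOverP => i j; rewrite mxE complex_real.
have Bsp := orthomx_spectralP (hermitian_normalmx Bh).
have spr := hermitian_spectral_diag_real Bh.
have Bchar : char_poly B = \prod_(i < n) ('X - (spectral_diag B 0 i)%:P).
  rewrite {1}Bsp char_poly_conj ?spectral_unit // char_poly_trig.
    by apply: eq_bigr => i _; rewrite !mxE eqxx.
  exact/diag_mx_is_trig.
exists [seq complex.Re (spectral_diag B 0 i) | i <- enum 'I_n].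
apply: (map_poly_inj (real_complex R)).
rewrite map_char_poly -/B Bchar rmorph_prod /= big_map big_enum /=.
apply: eq_bigr => i _.
by rewrite rmorphB /= map_polyX map_polyC /= RRe_real //; exact/mxOverP.
Qed.

Lemma size_spectrum n (A : 'M[R]_n) : A^T = A -> size (spectrum A) = n.
Proof.
move=> /char_poly_spectrum /(congr1 (fun p : {poly R} => size p)).
by rewrite size_char_poly size_prod_XsubC => -[].
Qed.

End Spectrum.

(* Main.v *)
(* Let [H_m(x,y)] be the number of non-backtracking walks of length at most m *)
(* from x to y.  Then [H_(m+2) = A H_(m+1) - (d-1) H_m], so [H_m = G_m(A)]    *)
(* for a polynomial [G_m].  The matrix [H_k - J] is nonnegative, because the  *)
(* diameter is k, and its row sums are [mu_(d,k) - n <= C d^(k/2)].  Hence    *)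
(* [|G_k(l)| <= C d^(k/2)] for each eigenvalue l with an eigenvector          *)
(* orthogonal to the constants, while by the recurrence                       *)
(* [|G_k(l)| >= ((C+1) sqrt d)^k] as soon as [|l| >= (C+2) sqrt d].           *)
Require Import Defs.
From mathcomp Require Import all_boot all_order all_algebra.
From mathcomp Require Import reals exp.
From mathcomp Require Import polyrcf complex ring lra zify.

Set Implicit Arguments.
Unset Strict Implicit.

Import Order.TTheory GRing.Theory Num.Theory.
Local Open Scope ring_scope.

(** The diameter hypothesis makes every entry of H_k at least 1 ([nb_diameter_gt0]), and each row of
    H_k sums to the Moore bound ([sum_nb]). So the absolute row sums of H_k - J equal the defect,
    which bounds its eigenvalues ([moore_poly_eigenvalue_le]), while [moore_poly_large] makes
    |G_k(l)| exceed the defect once |l| is a large multiple of sqrt d. This reaches all of lambda_2,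
    ..., lambda_n because each has an eigenvector orthogonal to the constants, even when its value
    is d ([spectrum_tail_orthogonal]). *)

(** * Counting non-backtracking walks *)

Section NonBacktracking.
Local Open Scope nat_scope.
Variables (T : finType) (e : rel T).

(* [nb m x y] counts the non-backtracking walks of length at most m from x to *)
(* y, and [nb_from m a x y] those whose first step does not go to a.          *)
Fixpoint nb_from (m : nat) (a x y : T) : nat :=
  (x == y) + if m is m'.+1 then
    \sum_(z | e x z && (z != a)) nb_from m' x z y else 0.

Definition nb (m : nat) (x y : T) : nat :=
  (x == y) + if m is m'.+1 then \sum_(z | e x z) nb_from m' x z y else 0.

Lemma nb_fromS m a x y : e x a ->
  nb m.+1 x y = nb_from m.+1 a x y + nb_from m x a y.
Proof.
move=> exa; rewrite /nb /= (bigD1 a) //=; lia.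
Qed.

Hypothesis esym : symmetric e.

(** A walk of positive length has a single first step, so it is excluded for one of the d values of
    z and counted d - 1 times; the trivial walk is counted d times, whence the extra [x == y]. *)
Lemma sum_nb_from d m x y : regular e d -> 0 < d ->
  \sum_(z | e x z) nb_from m z x y = (x == y) + d.-1 * nb m x y.
Proof.
move=> dreg d_gt0; have cd := dreg x.
case: m => [|m] /=.
  rewrite /nb sum_nat_cond_const cd; nia.
rewrite big_split /= sum_nat_cond_const cd.
under eq_bigr => z ez do rewrite big_mkcondr /=.
rewrite exchange_big /= /nb mulnDr.
suff -> : \sum_(j | e x j) \sum_(i | e x i)
      (if j != i then nb_from m x j y else 0) =
    d.-1 * \sum_(j | e x j) nb_from m x j y by nia.
rewrite big_distrr; apply: eq_bigr => j ej /=.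
rewrite (bigD1 j) //= eqxx add0n.
rewrite (eq_bigr (fun=> nb_from m x j y)); last first.
  by move=> i /andP[_]; rewrite eq_sym => ->.
rewrite sum_nat_cond_const; congr (_ * _).
rewrite -cd [in RHS](cardsD1 j) inE ej add1n /=.
by apply: eq_card => i; rewrite !inE andbC.
Qed.

(** A walk from a neighbour z of x either does not step to x at once, and then x can be prepended,
    or it does, and continues from x without returning to z. [sum_nb_from] counts the second kind,
    and the two terms [x == y] cancel. *)
Lemma nb_rec d m x y : regular e d -> 0 < d ->
  nb m.+2 x y + d.-1 * nb m x y = \sum_(z | e x z) nb m.+1 z y.
Proof.
move=> dreg d0.
under [RHS]eq_bigr => z exz do rewrite (@nb_fromS m x z y) ?[e z x]esym //.
rewrite big_split /= (sum_nb_from _ _ _ dreg d0) {1}/nb /=; lia.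
Qed.

Lemma nb_from_le m a x y : nb_from m a x y <= nb m x y.
Proof.
case: m => [|m] //; rewrite /nb /= leq_add2l.
rewrite [leqRHS](bigID (fun z => z != a)) /=.
exact: leq_addr.
Qed.

Lemma nb_from_leS m a x y : nb_from m a x y <= nb_from m.+1 a x y.
Proof.
elim: m a x => [|m IHm] a x; first by rewrite /= addn0 leq_addr.
by rewrite /= leq_add2l; apply: leq_sum => z _; exact: IHm.
Qed.

Lemma nb_leS m x y : nb m x y <= nb m.+1 x y.
Proof.
case: m => [|m]; first by rewrite /nb addn0 leq_addr.
by rewrite /nb leq_add2l; apply: leq_sum => z _; exact: nb_from_leS.
Qed.

(* A walk counted by [nb m z y] either does not start with a step to x, and   *)
(* then prepending x to it gives one from x to y, or it starts with z, x, and *)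
(* then removing z from it does.                                              *)
Lemma nb_gt0_step m x y z : e x z -> 0 < nb m z y -> 0 < nb m.+1 x y.
Proof.
move=> exz nbz; have ezx : e z x by rewrite esym.
have first_step : nb_from m x z y <= nb m.+1 x y.
  by rewrite /nb (bigD1 z) //=; lia.
case: m nbz first_step => [|m]; first by move=> h /(leq_trans h).
rewrite (nb_fromS m y ezx) => h1 h2.
have := nb_from_le m z x y; have := nb_leS m x y; have := nb_leS m.+1 x y.
lia.
Qed.

Lemma path_nb_gt0 m x p : path e x p -> size p <= m -> 0 < nb m x (last x p).
Proof.
elim: m x p => [|m IHm] x [|z p] //; try by rewrite /nb eqxx.
by move=> /andP[exz pz] szp; exact: nb_gt0_step exz (IHm z p pz szp).
Qed.

Lemma sum_eq1 (x : T) : \sum_y (x == y : nat) = 1.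
Proof.
by rewrite (bigD1 x) //= eqxx big1 // => y /negbTE; rewrite eq_sym => ->.
Qed.

Lemma sum_nb_from_col d m a x : regular e d -> e x a ->
  \sum_y nb_from m a x y = \sum_(i < m.+1) d.-1 ^ i.
Proof.
move=> dreg; elim: m a x => [|m IHm] a x exa.
  rewrite big_ord1 expn0 -(sum_eq1 x); apply: eq_bigr => y _.
  by rewrite /= addn0.
rewrite /= big_split /= sum_eq1 exchange_big /= big_ord_recl expn0; congr addn.
rewrite (eq_bigr (fun=> \sum_(i < m.+1) d.-1 ^ i)); last first.
  by move=> z /andP[exz _]; apply: IHm; rewrite esym.
rewrite sum_nat_cond_const big_distrr /=.
have -> : #|[set z | e x z && (z != a)]| = d.-1.
  rewrite -(dreg x) [in RHS](cardsD1 a) inE exa add1n /=.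
  by apply: eq_card => i; rewrite !inE andbC.
by apply: eq_bigr => i _; rewrite expnS.
Qed.

(** There are d choices for the first step and d - 1 for each later one. *)
Lemma sum_nb d m x : regular e d -> \sum_y nb m x y = moore_bound d m.
Proof.
move=> dreg; rewrite /moore_bound /nb big_split /= sum_eq1; congr addn.
case: m => [|m]; first by rewrite big_ord0 muln0 big1.
rewrite exchange_big /= (eq_bigr (fun=> \sum_(i < m.+1) d.-1 ^ i)); last first.
  by move=> z exz; apply: sum_nb_from_col; rewrite // esym.
by rewrite sum_nat_cond_const dreg.
Qed.

Lemma walk_dist x y : connected e -> walk e (dist e x y) x y.
Proof.
move=> /(_ x y)/connectP[p /shortenP[q pq uq _] ->].
(* A path without repeated vertices has fewer than [#|T|] steps, so the search in [dist] succeeds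
   and its default value is not taken. *)
have sq : size q < #|T|.
  by rewrite -[(size q).+1]/(size (x :: q)) -(card_uniqP uq) max_card.
have hw : has (fun m => walk e m x (last x q)) (iota 0 #|T|).
  apply/hasP; exists (size q); first by rewrite mem_iota.
  by apply/existsP; exists (in_tuple q); rewrite /= pq eqxx.
move: (nth_find 0 hw); rewrite nth_iota //.
by move: hw; rewrite has_find size_iota.
Qed.

Lemma dist_le_diameter x y : dist e x y <= diameter e.
Proof.
apply: leq_trans (leq_bigmax (F := fun x => \max_y dist e x y) x).
exact: (leq_bigmax (F := fun y => dist e x y)).
Qed.

Lemma nb_diameter_gt0 x y : connected e -> 0 < nb (diameter e) x y.
Proof.
move=> econn; have /existsP[p /andP[pp /eqP <-]] := walk_dist x y econn.
by apply: path_nb_gt0; rewrite // size_tuple dist_le_diameter.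
Qed.

End NonBacktracking.

(** * The polynomials G_m: growth, and values at eigenvalues *)

Section MoorePolynomial.
Variable R : realFieldType.

(* The polynomial [G_m], with [c] standing for [d - 1].                       *)
Fixpoint moore_poly (c x : R) (m : nat) : R :=
  match m with
  | 0 => 1
  | 1 => x + 1
  | (m''.+1 as m').+1 => x * moore_poly c x m' - c * moore_poly c x m''
  end.

Lemma moore_poly_rec (c x : R) m :
  moore_poly c x m.+2 = x * moore_poly c x m.+1 - c * moore_poly c x m.
Proof. by []. Qed.

(** By induction, |G_(m+2)| >= (a + b)|G_(m+1)| - ab|G_m| >= (a + b)|G_(m+1)| - b|G_(m+1)|. The base
    case |x + 1| >= a uses b >= 1. *)
Lemma moore_poly_growth (a b c x : R) m : 0 <= a -> 1 <= b -> 0 <= c <= a * b ->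
  a + b <= `|x| -> a * `|moore_poly c x m| <= `|moore_poly c x m.+1|.
Proof.
move=> a0 b1 /andP[c0 cab] xab.
elim: m => [|m IHm].
  rewrite /= normr1 mulr1; have := lerB_normD x 1; rewrite normr1; lra.
rewrite moore_poly_rec.
apply: le_trans (lerB_dist (x * moore_poly c x m.+1) (c * moore_poly c x m)).
rewrite !normrM (ger0_norm c0).
have h1 : (a + b) * `|moore_poly c x m.+1| <= `|x| * `|moore_poly c x m.+1|.
  by rewrite ler_wpM2r.
have h2 : c * `|moore_poly c x m| <= a * b * `|moore_poly c x m|.
  by rewrite ler_wpM2r.
have h3 : b * (a * `|moore_poly c x m|) <= b * `|moore_poly c x m.+1|.
  by rewrite ler_wpM2l //; lra.
lra.
Qed.

Lemma moore_poly_large (a b c x : R) m : 0 <= a -> 1 <= b -> 0 <= c <= a * b ->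
  a + b <= `|x| -> a ^+ m <= `|moore_poly c x m|.
Proof.
move=> a0 b1 hc hx; elim: m => [|m IHm]; first by rewrite normr1.
have step := @moore_poly_growth a b c x m a0 b1 hc hx.
by rewrite exprS; apply: le_trans step; rewrite ler_wpM2l.
Qed.

Variables (T : finType) (e : rel T) (d : nat).
Hypotheses (esym : symmetric e) (ereg : regular e d) (d_gt0 : (0 < d)%N).

Lemma nb_eigenfunction (f : T -> R) (l : R) m x :
  (forall x, \sum_(z | e x z) f z = l * f x) ->
  \sum_y (nb e m x y)%:R * f y = moore_poly d.-1%:R l m * f x.
Proof.
move=> fl.
have f0 x' : \sum_y (x' == y)%:R * f y = f x'.
  rewrite (bigD1 x') //= eqxx mul1r big1 ?addr0 // => y /negbTE.
  by rewrite eq_sym => ->; rewrite mul0r.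
(* The recurrence has order two, so the induction carries two consecutive values of m. *)
suff [] : \sum_y (nb e m x y)%:R * f y = moore_poly d.-1%:R l m * f x /\
    \sum_y (nb e m.+1 x y)%:R * f y = moore_poly d.-1%:R l m.+1 * f x.
  by [].
elim: m x => [|m IHm] x.
  split.
    by rewrite mul1r -[RHS]f0; apply: eq_bigr => y _; rewrite /nb addn0.
  rewrite /= mulrDl mul1r -fl -[f x in RHS]f0.
  under [X in _ = X + _]eq_bigr => z _ do rewrite -(f0 z).
  rewrite exchange_big -big_split /=; apply: eq_bigr => y _.
  rewrite /nb natrD mulrDl addrC; congr (_ + _).
  by rewrite natr_sum mulr_suml; apply: eq_bigr => z _; rewrite /= addn0.
split; first exact: (IHm x).2.
have -> : \sum_y (nb e m.+2 x y)%:R * f y =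
    \sum_(z | e x z) \sum_y (nb e m.+1 z y)%:R * f y
    - d.-1%:R * \sum_y (nb e m x y)%:R * f y.
  rewrite exchange_big mulr_sumr -sumrB; apply: eq_bigr => y _ /=.
  rewrite -mulr_suml -natr_sum -(nb_rec esym m x y ereg d_gt0) natrD natrM.
  ring.
rewrite (eq_bigr _ (fun z _ => (IHm z).2)) (IHm x).1 -mulr_sumr fl.
rewrite moore_poly_rec; ring.
Qed.

(** Evaluate the eigenvalue equation at a point where |f| is largest. *)
Lemma eigenvalue_le_row_sum (M : T -> T -> R) (f : T -> R) (l K : R) :
  (exists x, f x != 0) -> (forall x, \sum_y M x y * f y = l * f x) ->
  (forall x, \sum_y `|M x y| <= K) -> `|l| <= K.
Proof.
move=> [x0 fx0] Mf MK.
have [x _ xmax] :=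
  arg_maxP (i0 := x0) (P := xpredT) (fun x => `|f x|) isT.
have fx : 0 < `|f x| by apply: lt_le_trans (xmax x0 isT); rewrite normr_gt0.
rewrite -(ler_pM2r fx) -normrM -Mf; apply: le_trans (ler_norm_sum _ _ _) _.
apply: le_trans (_ : (\sum_y `|M x y|) * `|f x| <= _); last first.
  by rewrite ler_wpM2r.
rewrite mulr_suml; apply: ler_sum => y _; rewrite normrM ler_wpM2l //.
exact: xmax.
Qed.

Lemma eigenvalue_le_degree (f : T -> R) (l : R) :
  (exists x, f x != 0) -> (forall x, \sum_(z | e x z) f z = l * f x) ->
  `|l| <= d%:R.
Proof.
move=> f0 fl; apply: (@eigenvalue_le_row_sum (fun x y => (e x y)%:R) f) => // x.
  rewrite -fl [RHS]big_mkcond; apply: eq_bigr => y _.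
  by case: (e x y); rewrite ?mul1r ?mul0r.
under eq_bigr do rewrite normr_nat.
by rewrite -natr_sum -(ereg x) -sum1dep_card [in leRHS]big_mkcond.
Qed.

(* The matrix [nb - J] is nonnegative, and on functions of zero sum it acts   *)
(* as [nb].                                                                   *)
Lemma moore_poly_eigenvalue_le (f : T -> R) (l : R) : connected e ->
  (exists x, f x != 0) -> (forall x, \sum_(z | e x z) f z = l * f x) ->
  \sum_x f x = 0 ->
  `|moore_poly d.-1%:R l (diameter e)| <=
    (moore_bound d (diameter e))%:R - #|T|%:R.
Proof.
move=> econn f0 fl fsum.
pose M x y : R := (nb e (diameter e) x y)%:R - 1.
apply: (@eigenvalue_le_row_sum M f) => // x.
  under eq_bigr do rewrite /M mulrBl mul1r.
  by rewrite sumrB fsum subr0 (nb_eigenfunction _ _ fl).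
rewrite -(sum_nb esym (diameter e) x ereg) natr_sum.
rewrite -[X in _ - X]sumr_const -sumrB; apply: ler_sum => y _.
by rewrite ger0_norm // subr_ge0 ler1n; exact: nb_diameter_gt0.
Qed.

End MoorePolynomial.

(** * Eigenvectors orthogonal to a given eigenvector *)

Section SymmetricSpectrum.
Variable R : realType.

Lemma spectrum_eigenvalue n (A : 'M[R]_n) a :
  A^T = A -> a \in spectrum A -> eigenvalue A a.
Proof.
move=> At.
by rewrite eigenvalue_root_char char_poly_spectrum // root_prod_XsubC.
Qed.

(* Two rows of the complex unitary diagonalisation have a nonzero combination *)
(* orthogonal to u; that the matrix [A - a | u] is not row free then descends *)
(* from the complex numbers to R.                                             *)
Lemma multiple_eigenvalue_orthogonal n (A : 'M[R]_n) (a : R) (u : 'cV[R]_n) :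
  A^T = A -> (1 < count_mem a (spectrum A))%N ->
  exists2 v : 'rV[R]_n, v *m A = a *: v /\ v *m u = 0 & v != 0.
Proof.
move=> At a2.
suff : ~~ row_free (row_mx (A - a%:M) u).
  rewrite -kermx_eq0 => /rowV0Pn[v /sub_kermxP vA v0]; exists v => //.
  move/eqP: vA; rewrite mul_mx_row row_mx_eq0 => /andP[/eqP vA /eqP vu].
  split=> //; apply/eqP; rewrite -subr_eq0 -mul_mx_scalar -mulmxBr; exact/eqP.
rewrite -(row_free_map (real_complex R)) map_row_mx map_mxB map_scalar_mx.
set B := map_mx _ A; set w := map_mx _ u.
have Bh : B \is hermsymmx.
  apply: realsym_hermsym.
    apply/is_hermitianmxP; rewrite expr0 scale1r.
    by apply/matrixP => i j; rewrite !mxE -{1}At mxE.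
  by apply/mxOverP => i j; rewrite mxE complex_real.
have Bsp := orthomx_spectralP (hermitian_normalmx Bh).
have spr := hermitian_spectral_diag_real Bh.
set P := spectralmx B in Bsp; set D := spectral_diag B in Bsp spr.
have Pu : P \in unitmx by exact: spectral_unit.
have Dre i : D 0 i = real_complex R (complex.Re (D 0 i)).
  by rewrite RRe_real //; exact/mxOverP.
have Achar : char_poly A =
    \prod_(y <- [seq complex.Re (D 0 i) | i <- enum 'I_n]) ('X - y%:P).
  apply: (map_poly_inj (real_complex R)).
  rewrite map_char_poly -/B Bsp char_poly_conj // char_poly_trig; last first.
    exact/diag_mx_is_trig.
  rewrite rmorph_prod /= big_map big_enum /=; apply: eq_bigr => i _.
  by rewrite rmorphB /= map_polyX map_polyC /= -Dre !mxE eqxx.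
have : (1 < #|[pred i : 'I_n | complex.Re (D 0 i)%R == a]|)%N.
  apply: leq_trans a2 _; have /permP/(_ (pred1 a)) -> := perm_spectrum Achar.
  by rewrite -sum1_count big_map big_enum_cond -sum1_card.
case/card_gt1P => i [j [/eqP Di /eqP Dj ij]].
have ker_q (q : 'cV_n) : exists c : 'rV_n,
    [/\ c *m diag_mx D = (real_complex R a) *: c, c *m q = 0 & c != 0].
  have dD k : complex.Re (D 0 k) = a ->
      delta_mx (0 : 'I_1) k *m diag_mx D = (real_complex R a) *: delta_mx 0 k.
    move=> Dk; apply/rowP => l; rewrite mul_mx_diag !mxE Dre.
    case: (eqVneq l k) => [->|]; first by rewrite Dk mulrC.
    by rewrite andbF mul0r mulr0.
  have dq k : delta_mx 0 k *m q = (q k 0)%:M.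
    by rewrite -rowE; apply/matrixP => r s; rewrite !ord1 !mxE eqxx.
  (* If q_i = 0, the basis vector e_i works; otherwise q_j e_i - q_i e_j does, its entry at j being
     nonzero. *)
  have [q0|q0] := eqVneq (q i 0) 0.
    exists (delta_mx 0 i); split; first exact: dD.
      by rewrite dq q0 raddf0.
    by apply/eqP => /rowP/(_ i)/eqP; rewrite !mxE !eqxx oner_eq0.
  exists (q j 0 *: delta_mx 0 i - q i 0 *: delta_mx 0 j); split.
  - rewrite mulmxBl -!scalemxAl (dD i Di) (dD j Dj) scalerBr !scalerA.
    by rewrite [q j 0 * _]mulrC [q i 0 * _]mulrC.
  - rewrite mulmxBl -!scalemxAl (dq i) (dq j) !scale_scalar_mx.
    by rewrite [q j 0 * _]mulrC subrr.
  apply/eqP => /rowP/(_ j)/eqP.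
  rewrite !mxE !eqxx [j == i]eq_sym (negbTE ij) /=.
  by rewrite mulr0 mulr1 sub0r oppr_eq0 (negbTE q0).
have [c [cD cq c0]] := ker_q (P *m w).
rewrite -kermx_eq0; apply/rowV0Pn; exists (c *m P).
  have cPB : c *m P *m (B - (real_complex R a)%:M) = 0.
    rewrite mulmxBr {1}Bsp !mulmxA mulmxK // cD mul_mx_scalar -scalemxAl.
    exact: subrr.
  by apply/sub_kermxP; rewrite mul_mx_row cPB -mulmxA cq row_mx0.
by apply: contra c0 => /eqP cP; rewrite -(mulmxK Pu c) cP mul0mx.
Qed.

(** If the eigenvalue at index i > 0 equals d, the one at index 0 does too, since d is an upper
    bound and the list is sorted; so d is a multiple eigenvalue. Otherwise, eigenvectors for
    distinct eigenvalues are orthogonal. *)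
Lemma spectrum_tail_orthogonal n (A : 'M[R]_n) (d : R) (u : 'cV[R]_n) i :
  A^T = A -> A *m u = d *: u -> (forall a, eigenvalue A a -> a <= d) ->
  (0 < i < n)%N ->
  exists2 v : 'rV[R]_n,
    v *m A = (spectrum A)`_i *: v /\ v *m u = 0 & v != 0.
Proof.
move=> At Au Ad /andP[i0 iN]; have sA := size_spectrum At.
have si : (spectrum A)`_i \in spectrum A by rewrite mem_nth ?sA.
have [sd|sd] := eqVneq (spectrum A)`_i d.
  apply: multiple_eigenvalue_orthogonal => //.
  have s0 : (spectrum A)`_0 = d.
    have n0 : (0 < n)%N := leq_trans i0 (ltnW iN).
    have ge_trans : transitive (>=%R : rel R).
      by move=> x y z xy yz; exact: le_trans yz xy.
    have ge_refl : reflexive (>=%R : rel R) by move=> x; exact: lexx.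
    apply/eqP; rewrite eq_le Ad ?spectrum_eigenvalue ?mem_nth ?sA //= -{1}sd.
    apply: (sorted_leq_nth ge_trans ge_refl 0 (spectrum_sorted A)) => //;
      by rewrite inE sA.
  move: sd s0 sA iN si; case: (spectrum A) => [|x s] /= sd s0 sA iN _.
    by rewrite -sA in iN.
  rewrite sd s0 eqxx add1n ltnS -has_count has_pred1 -sd.
  by case: i i0 sd iN => // i _ _; rewrite -sA ltnS => iN; exact: mem_nth.
have /eigenvalueP[v vA v0] := spectrum_eigenvalue At si.
exists v => //; split=> //.
have : v *m A *m u = v *m (A *m u) by rewrite mulmxA.
rewrite vA Au -scalemxAl -scalemxAr => /eqP; rewrite -subr_eq0 -scalerBl.
by rewrite scaler_eq0 subr_eq0 (negbTE sd) => /eqP.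
Qed.

End SymmetricSpectrum.

(** * From matrix eigenvectors to functions on the vertices *)

Section Adjacency.
Variables (R : realType) (T : finType) (e : rel T) (d : nat).
Hypotheses (esym : symmetric e) (ereg : regular e d).
Local Notation A := (adj_mx R e).

Lemma adj_mx_sym : A^T = A.
Proof. by apply/matrixP => i j; rewrite !mxE esym. Qed.

Lemma sum_enum_rank (F : 'I_#|T| -> R) : \sum_i F i = \sum_x F (enum_rank x).
Proof. by rewrite (reindex enum_rank) //=; exact/onW_bij/enum_rank_bij. Qed.

Lemma adj_mx_eigenfunction (v : 'rV[R]_#|T|) l : v *m A = l *: v ->
  forall x, \sum_(z | e x z) v 0 (enum_rank z) = l * v 0 (enum_rank x).
Proof.
move=> /rowP vA x; have := vA (enum_rank x); rewrite !mxE => <-.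
rewrite sum_enum_rank big_mkcond; apply: eq_bigr => z _.
by rewrite mxE !enum_rankK esym; case: (e z x); rewrite ?mulr1 ?mulr0.
Qed.

Lemma rV_neq0_enum_rank (v : 'rV[R]_#|T|) :
  v != 0 -> exists x, v 0 (enum_rank x) != 0.
Proof.
move=> /eqP v0; apply/existsP; apply: contra_notT v0.
rewrite negb_exists => /forallP h.
by apply/rowP => i; have := h (enum_val i); rewrite enum_valK mxE negbK => /eqP.
Qed.

Lemma adj_mx_eigenvalue_le a : eigenvalue A a -> a <= d%:R.
Proof.
case/eigenvalueP => v vA v0; apply: le_trans (ler_norm a) _.
have v0' := rV_neq0_enum_rank v0.
exact: (eigenvalue_le_degree ereg v0' (adj_mx_eigenfunction vA)).
Qed.

Lemma adj_mx_const1 : A *m const_mx 1 = d%:R *: (const_mx 1 : 'cV[R]_#|T|).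
Proof.
apply/colP => i; rewrite !mxE mulr1 -[in RHS](ereg (enum_val i)).
rewrite sum_enum_rank -sum1dep_card natr_sum [RHS]big_mkcond.
by apply: eq_bigr => z _; rewrite !mxE enum_rankK mulr1; case: (e _ z).
Qed.

Lemma adj_spectrum_tail_moore_poly i :
  connected e -> (0 < d)%N -> (0 < i < #|T|)%N ->
  `|moore_poly d.-1%:R (spectrum A)`_i (diameter e)| <=
    (moore_bound d (diameter e))%:R - #|T|%:R.
Proof.
move=> econn d0 iT.
have [v [vA v1] v0] := spectrum_tail_orthogonal adj_mx_sym adj_mx_const1
  adj_mx_eigenvalue_le iT.
pose f x := v 0 (enum_rank x).
apply: (moore_poly_eigenvalue_le esym ereg d0 (f := f) econn).
- exact: rV_neq0_enum_rank.
- exact: adj_mx_eigenfunction.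
move/rowP/(_ 0): v1; rewrite !mxE sum_enum_rank => v1; rewrite -[RHS]v1.
by apply: eq_bigr => x _; rewrite mxE mulr1.
Qed.

End Adjacency.

(** * The bound on lambda *)

Theorem theorem3p3 (R : realType) (k : nat) (hk : (1 <= k)%N) :
  forall C : R, 0 < C ->
  exists C' : R, 0 < C' /\
    forall (d : nat) (T : finType) (e : rel T),
      (1 <= d)%N ->
      dk_graph e d k ->
      (moore_bound d k)%:R - C * (d%:R `^ (k%:R / 2)) <= #|T|%:R ->
      lambda R e <= C' * Num.sqrt d%:R.
Proof.
(* With b = sqrt d and a = (C + 1) b, a + b = (C + 2) sqrt d and ab = (C + 1) d >= d - 1, as
   [moore_poly_large] requires. *)
move=> C C0; exists (C + 2); split; first lra.
move=> d T e d1 [esym eirr ereg econn ek] hn.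
(* An empty graph has diameter 0 and a single vertex has degree 0. Two vertices put the indices 1
   and [#|T|.-1] in the range of [tail]. *)
have T2 : (1 < #|T|)%N.
  rewrite ltnNge; apply/negP => T1; move: hk; rewrite -ek /diameter.
  rewrite big1 // => x; have := ereg x; rewrite (_ : [set y | e x y] = set0).
    by rewrite cards0 => d0; rewrite -d0 in d1.
  apply/setP => y; rewrite !inE; have /card_le1_eqP/(_ x y) -> := T1 => //.
set b : R := Num.sqrt d%:R.
have b1 : 1 <= b by rewrite -[leLHS]sqrtr1 ler_sqrt ?ler1n // ltr0n.
have b2 : b * b = d%:R by rewrite -expr2 sqr_sqrtr ?ler0n.
have dk : d%:R `^ (k%:R / 2) = b ^+ k :> R.
  by rewrite mulrC powRrM powR12_sqrt ?ler0n // powR_mulrn // sqrtr_ge0.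
rewrite dk in hn.
have tail i : (0 < i < #|T|)%N -> `|(spectrum (adj_mx R e))`_i| <= (C + 2) * b.
  move=> iT; have := adj_spectrum_tail_moore_poly R esym ereg econn d1 iT.
  rewrite ek => le_defect; rewrite leNgt; apply/negP => large.
  have cab : 0 <= (d.-1%:R : R) <= (C + 1) * b * b.
    rewrite ler0n -mulrA b2 /=; apply: le_trans (_ : d%:R <= _).
      by rewrite ler_nat leq_pred.
    by rewrite ler_peMl ?ler0n //; lra.
  have ab : (C + 1) * b + b <= `|(spectrum (adj_mx R e))`_i| by lra.
  have a0 : 0 <= (C + 1) * b by apply: mulr_ge0; lra.
  have := moore_poly_large k a0 b1 cab ab; rewrite exprMn.
  (* As k >= 1, a^k >= (C + 1) b^k > C b^k, which contradicts the bound by the defect. *)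
  have Ck : C + 1 <= (C + 1) ^+ k by apply: ler_eXnr => //; lra.
  have bk : 0 < b ^+ k by rewrite exprn_gt0 //; lra.
  have := ler_wpM2r (ltW bk) Ck.
  lra.
rewrite /lambda ge_max !tail //; lia.
Qed.
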